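(* For every bipartite state $\rho_{AB}$ on $\mathbb{C}^{d_A}\otimes\mathbb{C}^{d_B}$, $$D_{\rightarrow}(\rho_{AB})\le R^{\infty}_{\mathcal{E}}(\rho_{AB}):=\limsup_{n\to\infty}\frac{R_{\mathcal{E}}(\rho_{AB}^{\otimes n})}{n},$$ where $\rho_{AB}^{\otimes n}$ is regarded as a bipartite state on $\mathbb{C}^{d_A^n}\otimes\mathbb{C}^{d_B^n}$.
   Context: For $d\ge2$, $\mathcal{E}_d$ is the set of symmetrically extendible states on $\mathbb{C}^d\otimes\mathbb{C}^d$: $\sigma$ is symmetrically extendible if there is a state $\sigma_{ABB'}$ on $\mathbb{C}^d\otimes\mathbb{C}^d\otimes\mathbb{C}^d$ invariant under the swap of $B$ and $B'$ with $\mathrm{Tr}_{B'}\sigma_{ABB'}=\sigma$. $S(\rho\|\sigma)=\mathrm{Tr}[\rho\log\rho-\rho\log\sigma]$. For a state $\rho$ on $\mathbb{C}^{d_A}\otimes\mathbb{C}^{d_B}$ with $d=\max(d_A,d_B)$, let $\tilde\rho$ be $\rho$ embedded into $\mathbb{C}^d\otimes\mathbb{C}^d$, and $R_{\mathcal{E}}(\rho)=\delta_d\inf_{\sigma\in\mathcal{E}_d}S(\tilde\rho\|\sigma)$ with $\delta_d=\log d/\log\frac{2d}{d+1}$. The one-way distillable entanglement $D_{\rightarrow}(\rho)$ is the supremum of asymptotic rates $\lim_n\frac{\log d_n}{n}$ at which maximally entangled states of dimension $d_n\times d_n$ can be obtained from $\rho^{\otimes n}$, with fidelity tending to $1$, by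 local operations and classical communication from Alice to Bob only. *)

(* Defs.v *)
From HB Require Import structures.
From mathcomp Require Import all_boot all_order all_algebra.
From mathcomp Require Import complex.
From mathcomp Require Import all_classical all_reals all_analysis.
From mathcomp Require Import zify.

Set Implicit Arguments.
Unset Strict Implicit.
Unset Printing Implicit Defensive.

Import Order.TTheory GRing.Theory Num.Theory.
Import numFieldNormedType.Exports.
Local Open Scope classical_set_scope.
Local Open Scope ring_scope.

(* Index bookkeeping.  C^m (x) C^n is identified with C^(m*n) via the  *)
(* basis ordering |a>|b>  |->  a*n + b.                                *)

Lemma pidx_subproof m n (a : 'I_m) (b : 'I_n) : (a * n + b < m * n)%N.
Proof.
case: a b => a Ha [b Hb] /=.
have : (a.+1 * n <= m * n)%N by rewrite leq_mul2r Ha orbT.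
rewrite mulSn; lia.
Qed.

Definition pidx m n (a : 'I_m) (b : 'I_n) : 'I_(m * n) :=
  Ordinal (pidx_subproof a b).

Lemma fstI_subproof m n (i : 'I_(m * n)) : (i %/ n < m)%N.
Proof.
case: i => i Hi /=; have n0 : (0 < n)%N.
  by case: n Hi => [|n]; rewrite ?muln0.
by rewrite ltn_divLR.
Qed.

Lemma sndI_subproof m n (i : 'I_(m * n)) : (i %% n < n)%N.
Proof.
case: i => i Hi /=; have n0 : (0 < n)%N.
  by case: n Hi => [|n]; rewrite ?muln0.
by rewrite ltn_pmod.
Qed.

Definition fstI m n (i : 'I_(m * n)) : 'I_m := Ordinal (fstI_subproof i).
Definition sndI m n (i : 'I_(m * n)) : 'I_n := Ordinal (sndI_subproof i).

Lemma digit_subproof d n (a : 'I_(d ^ n)) (k : 'I_n) : ((a %/ d ^ k) %% d < d)%N.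
Proof.
case: d a => [|d] a; last by rewrite ltn_pmod.
case: n a k => [|n] a [k Hk] //.
by case: a => a /=; rewrite exp0n.
Qed.

(* the k-th tensor factor (base-d digit) of a basis index of (C^d)^(x n) *)
Definition digit d n (a : 'I_(d ^ n)) (k : 'I_n) : 'I_d :=
  Ordinal (digit_subproof a k).

Section Quantum.
Variable R : realType.
Local Notation C := (R[i]).

Definition dag m n (A : 'M[C]_(m, n)) : 'M[C]_(n, m) := map_mx Num.conj (A^T).

Definition psd n (A : 'M[C]_n) : Prop :=
  forall v : 'cV[C]_n, 0 <= (dag v *m A *m v) 0 0.

Definition density n (A : 'M[C]_n) : Prop := psd A /\ \tr A = 1.

Definition kron m n p q (A : 'M[C]_(m, n)) (B : 'M[C]_(p, q)) : 'M[C]_(m * p, n * q) :=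
  \matrix_(i, j) (A (fstI i) (fstI j) * B (sndI i) (sndI j)).

(* rho^{(x) n} for rho on C^dA (x) C^dB, regarded as a bipartite operator on
   C^(dA^n) (x) C^(dB^n) (all A systems grouped together, all B systems together) *)
Definition tpow dA dB (rho : 'M[C]_(dA * dB)) (n : nat) : 'M[C]_(dA ^ n * dB ^ n) :=
  \matrix_(i, j) \prod_(k < n)
     rho (pidx (digit (fstI i) k) (digit (sndI i) k))
         (pidx (digit (fstI j) k) (digit (sndI j) k)).

Definition embed dA dB (rho : 'M[C]_(dA * dB)) : 'M[C]_(maxn dA dB * maxn dA dB) :=
  \matrix_(i, j)
    match (insub (val (fstI i)) : option 'I_dA), (insub (val (sndI i)) : option 'I_dB),
          (insub (val (fstI j)) : option 'I_dA), (insub (val (sndI j)) : option 'I_dB) with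
    | Some a, Some b, Some a', Some b' => rho (pidx a b) (pidx a' b')
    | _, _, _, _ => 0
    end.

(* operators on A B B' = C^d (x) C^d (x) C^d, indexed as (A B) B' *)
Definition ptraceB' d (S : 'M[C]_(d * d * d)) : 'M[C]_(d * d) :=
  \matrix_(i, j) \sum_(c < d) S (pidx i c) (pidx j c).

Definition swapBB' d (i : 'I_(d * d * d)) : 'I_(d * d * d) :=
  pidx (pidx (fstI (fstI i)) (sndI i)) (sndI (fstI i)).

Definition sym_extendible d (sigma : 'M[C]_(d * d)) : Prop :=
  density sigma /\
  exists S : 'M[C]_(d * d * d),
    [/\ density S, (forall i j, S (swapBB' i) (swapBB' j) = S i j)
      & ptraceB' S = sigma].

(* Umegaki relative entropy S(rho||sigma) = Tr[rho log rho - rho log sigma]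
   (natural logarithm), computed from the spectral decompositions
   rho = U^* diag(p) U, sigma = V^* diag(q) V given by the library
   ([spectralmx], [spectral_diag]); convention 0 log 0 = 0 and value +oo
   when supp rho is not contained in supp sigma. *)
Definition relent n (rho sigma : 'M[C]_n) : \bar R :=
  let p i := complex.Re (spectral_diag rho 0 i) in
  let q j := complex.Re (spectral_diag sigma 0 j) in
  let W := spectralmx rho *m dag (spectralmx sigma) in
  let c i j := p i * complex.Re (W i j * Num.conj (W i j)) in
  ((\sum_(i < n) (if p i == 0 then 0 else p i * ln (p i)))%:E
   + \sum_(i < n) \sum_(j < n)
       (if c i j == 0%R then 0%E
        else if q j == 0%R then +oo%E else (- (c i j * ln (q j)))%:E))%E.

Definition delta_d (d : nat) : R := ln (d%:R) / ln (2 * d%:R / (d%:R + 1)).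

Definition R_E dA dB (rho : 'M[C]_(dA * dB)) : \bar R :=
  ((delta_d (maxn dA dB))%:E *
   ereal_inf [set relent (embed rho) sigma | sigma in [set s | sym_extendible s]])%E.

Definition R_E_inf dA dB (rho : 'M[C]_(dA * dB)) : \bar R :=
  limn_esup (fun n : nat => (R_E (tpow rho n) * (n%:R^-1)%:E)%E).

(* one-way LOCC (Alice -> Bob) operations from C^dA (x) C^dB to C^mA (x) C^mB:
   Alice performs an instrument {E_k} (Kraus operators A k j), communicates k,
   Bob applies a channel B_k (Kraus operators B k l). *)
Definition one_way_LOCC dA dB mA mB (Lam : 'M[C]_(dA * dB) -> 'M[C]_(mA * mB)) : Prop :=
  exists (K J L : nat) (A : 'I_K -> 'I_J -> 'M[C]_(mA, dA))
         (B : 'I_K -> 'I_L -> 'M[C]_(mB, dB)),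
    [/\ \sum_(k < K) \sum_(j < J) (dag (A k j) *m A k j) = 1%:M,
        (forall k, \sum_(l < L) (dag (B k l) *m B k l) = 1%:M)
      & forall X, Lam X = \sum_(k < K) \sum_(j < J) \sum_(l < L)
            (kron (A k j) (B k l) *m X *m dag (kron (A k j) (B k l)))].

(* fidelity <Phi_m| s |Phi_m> with the maximally entangled state
   |Phi_m> = m^{-1/2} sum_a |a>|a> on C^m (x) C^m *)
Definition fid_maxent m (s : 'M[C]_(m * m)) : R :=
  complex.Re (\sum_(a < m) \sum_(b < m) s (pidx a a) (pidx b b)) / m%:R.

Definition achievable_rate dA dB (rho : 'M[C]_(dA * dB)) (r : R) : Prop :=
  exists (m : nat -> nat)
         (Lam : forall n : nat, 'M[C]_(dA ^ n * dB ^ n) -> 'M[C]_(m n * m n)),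
    [/\ (forall n, 0 < m n)%N,
        (forall n, one_way_LOCC (Lam n)),
        (fun n => fid_maxent (Lam n (tpow rho n))) @ \oo --> (1 : R)
      & (fun n : nat => ln ((m n)%:R : R) / n%:R) @ \oo --> r].

Definition D_oneway dA dB (rho : 'M[C]_(dA * dB)) : \bar R :=
  ereal_sup [set r%:E | r in [set r | achievable_rate rho r]].

End Quantum.

(* Main.v *)
Require Import Defs.
From HB Require Import structures.
From mathcomp Require Import all_boot all_order all_algebra.
From mathcomp Require Import complex.
From mathcomp Require Import all_classical all_reals all_analysis.
From mathcomp Require Import ring lra zify.
Import Order.TTheory GRing.Theory Num.Theory.
Import numFieldNormedType.Exports.
Local Open Scope ring_scope.

(* In dimension d = D^n the factor delta_d is at least n log D / log 2, so it
   suffices to show that an achievable rate r satisfies r <= log D and that, when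
   r > 0, every symmetrically extendible sigma has
   S(rho^n || sigma) >= log 2 - o(1).

   Pull the projector on the maximally entangled state back through the one-way
   LOCC map: this gives a test 0 <= M <= 1 with Tr(rho^n M) equal to the fidelity,
   Tr(rho^n M) <= D^n / m (hence r <= log D), and, since two maximally entangled
   projectors on AB and AB' have a sum of norm 1 + 1/m, Tr(sigma M) <= (m + 1)/(2m),
   which tends to 1/2 because r > 0 forces m_n to infinity.

   No data-processing inequality is needed.  S(rho || sigma) is the classical
   divergence of the Nussbaum-Szkola distributions P_ij = p_i |<u_i|v_j>|^2 and
   Q_ij = q_j |<u_i|v_j>|^2, and splitting <u_i|v_j> with M and 1 - M bounds the
   sum of the harmonic means lam P Q / (lam P + Q) by
   lam Tr(rho (1 - M)) + Tr(sigma M); concavity of the logarithm then yields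
   S(rho || sigma) >= - log (lam Tr(rho (1 - M)) + Tr(sigma M)) - log (1 + 1/lam). *)

Set Implicit Arguments.
Unset Strict Implicit.

(** * Positive semidefinite matrices, their spectral and Gram forms *)

Section LinearAlgebra.
Variable R : realType.
Local Notation C := (R[i]).
Local Notation "x %:C" := (real_complex R x).

Lemma dagE m n (A : 'M[C]_(m, n)) i j : dag A i j = (A j i)^*.
Proof. by rewrite !mxE. Qed.

Lemma dagK m n (A : 'M[C]_(m, n)) : dag (dag A) = A.
Proof. by apply/matrixP => i j; rewrite !dagE conjCK. Qed.

Lemma dag1 n : dag (1%:M : 'M[C]_n) = 1%:M.
Proof. by apply/matrixP => i j; rewrite !mxE rmorph_nat eq_sym. Qed.

Lemma dagM m n p (A : 'M[C]_(m, n)) (B : 'M[C]_(n, p)) :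
  dag (A *m B) = dag B *m dag A.
Proof. by rewrite /dag trmx_mul map_mxM. Qed.

Lemma mulmx_dag_entry m n (A : 'M[C]_(m, n)) i :
  (A *m dag A) i i = \sum_j `|A i j| ^+ 2.
Proof. by rewrite mxE; apply: eq_bigr => j _; rewrite dagE normCK. Qed.

Lemma dag_mulmx_entry m n (A : 'M[C]_(m, n)) i :
  (dag A *m A) i i = \sum_j `|A j i| ^+ 2.
Proof. by rewrite mxE; apply: eq_bigr => j _; rewrite dagE normCK mulrC. Qed.

Lemma trace_dag_mulmx m n (A : 'M[C]_(m, n)) :
  \tr (dag A *m A) = \sum_i \sum_j `|A j i| ^+ 2.
Proof. by apply: eq_bigr => i _; rewrite dag_mulmx_entry. Qed.

Lemma gram_psd m n (Y : 'M[C]_(m, n)) : psd (dag Y *m Y).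
Proof.
move=> v; rewrite mulmxA -dagM -mulmxA dag_mulmx_entry.
by apply: sumr_ge0 => j _; rewrite exprn_ge0.
Qed.

Lemma psd_conj m n (K : 'M[C]_(m, n)) (A : 'M[C]_m) :
  psd A -> psd (dag K *m A *m K).
Proof. by move=> hA v; rewrite !mulmxA -dagM -mulmxA hA. Qed.

Lemma psdD n (A B : 'M[C]_n) : psd A -> psd B -> psd (A + B).
Proof. by move=> hA hB v; rewrite mulmxDr mulmxDl mxE addr_ge0. Qed.

(* Polarization with test vectors [e_i + e_j] and [e_i + 'i e_j]. *)
Lemma form_eq0 n (B : 'M[C]_n) :
  (forall v : 'cV[C]_n, (dag v *m B *m v) 0 0 = 0) -> B = 0.
Proof.
move=> hB.
have hE (x y : C) i j :
    (dag (x *: delta_mx i 0 + y *: delta_mx j 0 : 'cV[C]_n) *m B *m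
      (x *: delta_mx i 0 + y *: delta_mx j 0 : 'cV[C]_n)) 0 0 =
    x^* * x * B i i + x^* * y * B i j + y^* * x * B j i + y^* * y * B j j.
  have -> : dag (x *: delta_mx i 0 + y *: delta_mx j 0 : 'cV[C]_n) =
      x^* *: delta_mx 0 i + y^* *: delta_mx 0 j.
    apply/matrixP => k l; rewrite !mxE rmorphD !rmorphM /= !rmorph_nat.
    by rewrite !(andbC (l == _)).
  rewrite !(mulmxDl, mulmxDr) -!scalemxAr -!scalemxAl -!rowE -!colE !mxE; ring.
have d k : B k k = 0.
  have := hB (1 *: delta_mx k 0 + 0 *: delta_mx k 0).
  by rewrite hE !(rmorph1, rmorph0, mulr0, mul0r, mulr1, mul1r, addr0).
apply/matrixP => i j; rewrite mxE.
have := hB (1 *: delta_mx i 0 + 1 *: delta_mx j 0).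
have := hB (1 *: delta_mx i 0 + 'i *: delta_mx j 0).
rewrite !hE !d !(rmorph1, mulr0, mul1r, addr0, add0r, mulr1) conjCi => h1 h2.
have h3 : 'i * B i j *+ 2 = 0.
  have -> : 'i * B i j *+ 2 = ('i * B i j + - 'i * B j i) + 'i * (B i j + B j i).
    by ring.
  by rewrite h1 h2 mulr0 addr0.
move/eqP: h3; rewrite mulrn_eq0 /= mulf_eq0 (negPf (neq0Ci _)) /=.
by move/eqP.
Qed.

(** Nonnegative elements of [R[i]] are real, so the form of A equals its own conjugate, which is the
    form of [dag A]; the difference then has zero form. *)
Lemma psd_herm n (A : 'M[C]_n) : psd A -> dag A = A.
Proof.
move=> hA; apply/eqP; rewrite eq_sym -subr_eq0; apply/eqP/form_eq0 => v.
rewrite mulmxBr mulmxBl mxE [X in _ + X]mxE.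
have -> : dag v *m dag A *m v = dag (dag v *m A *m v).
  by rewrite !dagM dagK mulmxA.
by rewrite dagE geC0_conj ?subrr ?hA.
Qed.

Lemma spectral_unitary n (A : 'M[C]_n) :
  spectralmx A *m dag (spectralmx A) = 1%:M /\
  dag (spectralmx A) *m spectralmx A = 1%:M.
Proof.
have /unitarymxP h : spectralmx A \is unitarymx by apply: spectral_unitarymx.
have h1 : spectralmx A *m dag (spectralmx A) = 1%:M.
  exact: h.
by split=> //; apply: mulmx1C.
Qed.

Definition specval n (A : 'M[C]_n) i : R := complex.Re (spectral_diag A 0 i).

(** A Hermitian matrix is normal, so the spectral theorem applies. Each eigenvalue is a diagonal
    entry of U A U^*, hence a value of the quadratic form, and taking its real part loses
    nothing. *)
Lemma psd_spectral n (A : 'M[C]_n) : psd A ->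
  (forall i, 0 <= specval A i) /\
  A = dag (spectralmx A) *m diag_mx (\row_i (specval A i)%:C) *m spectralmx A.
Proof.
move=> hA; have [U1 U2] := spectral_unitary A.
have nA : A \is normalmx.
  apply/normalmxP; have h : (map_mx Num.conj A^T) = A by exact: psd_herm.
  by rewrite h.
have /orthomx_spectralP AE := nA.
have iU : invmx (spectralmx A) = dag (spectralmx A).
  by rewrite invmx_unitary ?spectral_unitarymx.
rewrite iU in AE.
have dE i : spectral_diag A 0 i = (spectralmx A *m A *m dag (spectralmx A)) i i.
  rewrite [X in _ *m X *m _]AE !mulmxA U1 mul1mx -mulmxA U1 mulmx1.
  by rewrite mxE eqxx mulr1n.
have d0 i : 0 <= spectral_diag A 0 i.
  have := hA (dag (row i (spectralmx A))); rewrite dagK dE.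
  rewrite -row_mul mxE [X in _ -> _ <= X]mxE; congr (0 <= _).
  by apply: eq_bigr => j _; rewrite !dagE !mxE.
have pE i : (specval A i)%:C = spectral_diag A 0 i.
  by rewrite /specval RRe_real // ger0_real.
split=> [i|]; first by rewrite -ler0c pE.
rewrite [LHS]AE; congr (_ *m diag_mx _ *m _).
by apply/rowP => i; rewrite mxE pE.
Qed.

Lemma psd_gram n (A : 'M[C]_n) : psd A -> exists Y : 'M[C]_n, A = dag Y *m Y.
Proof.
move=> /psd_spectral [p0 AE].
exists (diag_mx (\row_i (Num.sqrt (specval A i))%:C) *m spectralmx A).
rewrite dagM mulmxA -(mulmxA _ (dag _)) {1}AE; congr (_ *m _ *m _).
apply/matrixP => i j; rewrite mul_mx_diag !mxE.
have [->|ij] := eqVneq i j; last by rewrite !mulr0n rmorph0 mul0r.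
rewrite !mulr1n geC0_conj ?ler0c ?sqrtr_ge0 // -?rmorphM /= -?expr2 ?sqr_sqrtr //.
Qed.

Lemma psd_trace_ge0 n (A : 'M[C]_n) : psd A -> 0 <= \tr A.
Proof.
move=> /psd_gram [Y ->]; rewrite trace_dag_mulmx.
by apply: sumr_ge0 => i _; apply: sumr_ge0 => j _; rewrite exprn_ge0.
Qed.

Lemma psd_trace_mul_ge0 n (A B : 'M[C]_n) : psd A -> psd B -> 0 <= \tr (A *m B).
Proof.
move=> /psd_gram [Y ->] hB; rewrite -mulmxA mxtrace_mulC.
by apply: psd_trace_ge0; have := psd_conj (dag Y) hB; rewrite dagK.
Qed.

(** With N = 1 - M, which commutes with M, the difference M - M^2 = M N equals N M N + M N M, a sum
    of two congruences of positive matrices. *)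
Lemma effect_sub_sq n (M : 'M[C]_n) :
  psd M -> psd (1%:M - M) -> psd (M - M *m M).
Proof.
move=> hM hN; have eM := psd_herm hM; have eN := psd_herm hN.
have -> : M - M *m M = dag (1%:M - M) *m M *m (1%:M - M) + dag M *m (1%:M - M) *m M.
  by rewrite eM eN mulmxBl mul1mx (mulmxBr M) mulmx1 mulmxBr mulmx1 subrK.
by apply: psdD; apply: psd_conj.
Qed.

(** After multiplication by x + y the difference of the two sides is |x u - y v|^2. *)
Lemma harmonic_mean_le (x y : R) (u v : C) : 0 <= x -> 0 <= y ->
  (x * y / (x + y))%:C * `|u + v| ^+ 2 <= x%:C * `|u| ^+ 2 + y%:C * `|v| ^+ 2.
Proof.
move=> x0 y0; case: u => a b; case: v => c d.
rewrite -!add_Re2_Im2 -!rmorphM -rmorphD /= lecR.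
have [/eqP|xy0] := eqVneq (x + y) 0.
  rewrite paddr_eq0 // => /andP[/eqP -> /eqP ->]; rewrite !mul0r; lra.
have xy : 0 < x + y by rewrite lt_neqAle eq_sym xy0 addr_ge0.
rewrite mulrAC ler_pdivrMr //.
have : 0 <= (x * a - y * c) ^+ 2 + (x * b - y * d) ^+ 2 by rewrite addr_ge0 ?sqr_ge0.
nra.
Qed.

End LinearAlgebra.

(** * Lower bound on the relative entropy from a two-outcome test *)

Section RelativeEntropy.
Variable R : realType.
Local Notation C := (R[i]).
Local Notation "x %:C" := (real_complex R x).

Lemma trace_mul_spectral n (A X : 'M[C]_n) : psd A ->
  \tr (A *m X) =
  \sum_i (specval A i)%:C * (spectralmx A *m X *m dag (spectralmx A)) i i.
Proof.
move=> /psd_spectral [_ AE]; rewrite {1}AE -!mulmxA mxtrace_mulC -!mulmxA.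
apply: eq_bigr => i _.
by rewrite mul_diag_mx !mxE mulr_sumr; apply: eq_bigr => j _; rewrite !mxE mulrA.
Qed.

Lemma sum_specval n (A : 'M[C]_n) : density A -> \sum_i specval A i = 1.
Proof.
move=> [hA trA]; apply: (@complexI R); rewrite rmorph_sum rmorph1 /= -trA.
rewrite -[in RHS](mulmx1 A) trace_mul_spectral //; apply: eq_bigr => i _.
by rewrite mulmx1 (spectral_unitary A).1 mxE eqxx mulr1.
Qed.

Lemma ln_le_tangent (a x : R) : 0 < a -> 0 < x -> ln x <= ln a + x / a - 1.
Proof.
move=> a0 x0; have xa : 0 < x / a by rewrite divr_gt0.
have -> : ln x = ln a + ln (x / a) by rewrite ln_div ?posrE //; lra.
have := le_ln1Dx (x := x / a - 1); rewrite addrCA subrr addr0; lra.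
Qed.

(* With t = q / p and f = lam t / (lam + t), so that t = f (1 + t / lam), bound
   ln f and ln (1 + t / lam) by the tangents of ln at a and at 1 + 1 / lam. *)
Lemma ln_le_harmonic (lam a p q : R) : 0 < lam -> 0 < a -> 0 < p -> 0 < q ->
  ln q <= ln p + ln a + ln (1 + lam^-1) - 1 - (lam + 1)^-1
     + a^-1 * (lam * q / (lam * p + q)) + (lam + 1)^-1 * (q / p).
Proof.
move=> lam0 a0 p0 q0.
have lpq : 0 < lam * p + q by rewrite addr_gt0 // mulr_gt0.
have l1 : 0 < lam + 1 by lra.
set f := lam * q / (lam * p + q).
have f0 : 0 < f by rewrite divr_gt0 ?mulr_gt0.
have k0 : 0 < 1 + q / p / lam by rewrite addr_gt0 // !divr_gt0.
have k1 : 0 < 1 + lam^-1 by rewrite addr_gt0 // invr_gt0.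
have h1 := ln_le_tangent a0 f0.
have h2 := ln_le_tangent k1 k0.
have e2 : (1 + q / p / lam) / (1 + lam^-1) - 1 =
    (lam + 1)^-1 * (q / p) - (lam + 1)^-1.
  by field; rewrite gt_eqF //= !gt_eqF.
have h3 : ln f = ln q - ln p - ln (1 + q / p / lam).
  have -> : f = q / p / (1 + q / p / lam).
    rewrite /f; field; rewrite !gt_eqF //=.
    by rewrite (_ : p * lam + q = lam * p + q) // mulrC.
  by rewrite !ln_div ?posrE ?divr_gt0.
move: h1 h2; rewrite -[X in _ <= X -> _]addrA -[X in _ -> _ <= X -> _]addrA e2 h3.
rewrite [f / a]mulrC; lra.
Qed.

Section Test.
Variables (n : nat) (rho sigma M : 'M[C]_n).
Hypotheses (drho : density rho) (dsigma : density sigma).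
Hypotheses (hM : psd M) (hN : psd (1%:M - M)).

Let U := spectralmx rho.
Let V := spectralmx sigma.
Let p := specval rho.
Let q := specval sigma.
(** Overlaps of the two eigenbases. Their squared moduli [w] form a doubly stochastic matrix, so
    [p i * w i j] and [q j * w i j] are both probability distributions. *)
Let W := U *m dag V.
Let w i j : R := complex.Re (W i j * (W i j)^*).

Let wE i j : (w i j)%:C = `|W i j| ^+ 2.
Proof. by rewrite /w RRe_real -normCK // ger0_real ?exprn_ge0. Qed.

Let w_ge0 i j : 0 <= w i j.
Proof. by rewrite -ler0c wE exprn_ge0. Qed.

Let sum_w_row i : \sum_j w i j = 1.
Proof.
apply: (@complexI R); rewrite rmorph_sum rmorph1 /=.
under eq_bigr do rewrite wE.
rewrite -mulmx_dag_entry /W dagM dagK mulmxA -(mulmxA U).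
by rewrite (spectral_unitary sigma).2 mulmx1 (spectral_unitary rho).1 mxE eqxx.
Qed.

Let sum_w_col j : \sum_i w i j = 1.
Proof.
apply: (@complexI R); rewrite rmorph_sum rmorph1 /=.
under eq_bigr do rewrite wE.
rewrite -dag_mulmx_entry /W dagM dagK mulmxA -(mulmxA V).
by rewrite (spectral_unitary rho).2 mulmx1 (spectral_unitary sigma).1 mxE eqxx.
Qed.

Let p_ge0 i : 0 <= p i. Proof. exact: (psd_spectral drho.1).1. Qed.
Let q_ge0 i : 0 <= q i. Proof. exact: (psd_spectral dsigma.1).1. Qed.

(* W splits as U N V^* + U M V^* with N = 1 - M; both error terms of the test
   dominate the corresponding squared amplitudes because N^2 <= N and M^2 <= M. *)
Lemma test_harmonic_mean (lam a : R) : 0 < lam ->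
  lam%:C * \tr (rho *m (1%:M - M)) + \tr (sigma *m M) <= a%:C ->
  \sum_i \sum_j w i j * (lam * p i * q j / (lam * p i + q j)) <= a.
Proof.
move=> lam0 ha; rewrite -lecR; apply: le_trans ha.
set N := 1%:M - M.
have tr_sq (A P : 'M[C]_n) : psd A -> psd P -> psd (1%:M - P) ->
    \tr (A *m (P *m P)) <= \tr (A *m P).
  move=> hA hP hP'; rewrite -subr_ge0 -raddfB /= -mulmxBr.
  by apply: psd_trace_mul_ge0 => //; apply: effect_sub_sq.
have hN' : psd (1%:M - N) by rewrite /N opprB addrC subrK.
apply: le_trans (_ : lam%:C * \tr (rho *m (N *m N)) + \tr (sigma *m (M *m M)) <= _);
  last first.
  apply: lerD; last by apply: tr_sq => //; case: dsigma.
  by apply: ler_wpM2l; [rewrite ler0c ltW | apply: tr_sq => //; case: drho].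
pose al := U *m N *m dag V; pose be := U *m M *m dag V.
have WE i j : W i j = al i j + be i j.
  have -> : W = al + be by rewrite -mulmxDl -mulmxDr subrK mulmx1.
  by rewrite mxE.
have -> : \tr (rho *m (N *m N)) = \sum_i \sum_j (p i)%:C * `|al i j| ^+ 2.
  rewrite trace_mul_spectral; last by case: drho.
  apply: eq_bigr => i _; rewrite -mulr_sumr -mulmx_dag_entry; congr (_ * _).
  rewrite /al !dagM dagK (psd_herm hN) !mulmxA -(mulmxA (U *m N) (dag V)).
  by rewrite (spectral_unitary sigma).2 mulmx1.
have -> : \tr (sigma *m (M *m M)) = \sum_i \sum_j (q j)%:C * `|be i j| ^+ 2.
  rewrite trace_mul_spectral; last by case: dsigma.
  rewrite exchange_big; apply: eq_bigr => j _; rewrite -mulr_sumr -dag_mulmx_entry.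
  congr (_ * _); rewrite /be !dagM dagK (psd_herm hM) !mulmxA -(mulmxA (V *m M) (dag U)).
  by rewrite (spectral_unitary rho).2 mulmx1.
rewrite mulr_sumr -big_split rmorph_sum /=; apply: ler_sum => i _.
rewrite mulr_sumr -big_split rmorph_sum /=; apply: ler_sum => j _.
rewrite rmorphM /= wE WE mulrC mulrA -rmorphM.
by apply: harmonic_mean_le => //; rewrite mulr_ge0 // ltW.
Qed.

(** This is [ln_le_harmonic] multiplied by [p i * w i j]. When that weight is zero, only two
    subtracted nonnegative terms remain on the left; when [q j] alone is zero, the right side is
    infinite. *)
Let relent_term_ge (lam a : R) i j : 0 < lam -> 0 < a ->
  (((p i * w i j * (- ln (p i) - ln a - ln (1 + lam^-1) + 1 + (lam + 1)^-1)
    - a^-1 * (w i j * (lam * p i * q j / (lam * p i + q j)))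
    - (lam + 1)^-1 * (q j * w i j))%R)%:E <=
  if (p i * w i j)%R == 0%R then 0
  else if q j == 0%R then +oo else (- (p i * w i j * ln (q j))%R)%:E)%E.
Proof.
move=> lam0 a0; have l1 : 0 < lam + 1 by lra.
have w0 := w_ge0 i j; have p0 := p_ge0 i; have q0 := q_ge0 j.
have h0 : 0 <= lam * p i * q j / (lam * p i + q j).
  by rewrite divr_ge0 ?addr_ge0 ?mulr_ge0 // ltW.
case: eqVneq => [c0|cn0].
  rewrite lee_fin c0 mul0r sub0r -opprD oppr_le0.
  have ia : 0 <= a^-1 by rewrite invr_ge0 ltW.
  have il : 0 <= (lam + 1)^-1 by rewrite invr_ge0 ltW.
  by apply: addr_ge0; apply: mulr_ge0 => //; apply: mulr_ge0.
case: eqVneq => [_|qn0]; first by rewrite leey.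
rewrite lee_fin.
move: cn0; rewrite mulf_eq0 negb_or => /andP[pn0 wn0].
have pp : 0 < p i by rewrite lt_neqAle eq_sym pn0.
have qp : 0 < q j by rewrite lt_neqAle eq_sym qn0.
have key := ln_le_harmonic lam0 a0 pp qp.
have pw : 0 <= p i * w i j by rewrite mulr_ge0.
have := ler_wpM2l pw key.
have qE : p i * w i j * (q j / p i) = q j * w i j.
  by rewrite [p i * _]mulrC -mulrA [p i * _]mulrC divfK // mulrC.
have fE : p i * w i j * (lam * q j / (lam * p i + q j)) =
    w i j * (lam * p i * q j / (lam * p i + q j)) by rewrite !mulrA; congr (_ / _); ring.
rewrite mulrDr [X in _ <= _ + X -> _]mulrCA qE.
rewrite mulrDr [X in _ <= _ + X + _ -> _]mulrCA fE.
lra.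
Qed.

(** In the sum of the termwise bounds the [ln (p i)] terms cancel the entropy sum of rho. The
    constant 1 absorbs [a^-1] times the harmonic sum, which is at most 1, and [(lam + 1)^-1] cancels
    because the [q j * w i j] sum to 1. *)
Lemma relent_ge_test (lam a : R) : 0 < lam -> 0 < a ->
  lam%:C * \tr (rho *m (1%:M - M)) + \tr (sigma *m M) <= a%:C ->
  ((- ln a - ln (1 + lam^-1))%:E <= relent rho sigma)%E.
Proof.
move=> lam0 a0 ha; have l1 : 0 < lam + 1 by lra.
have hh := test_harmonic_mean lam0 ha.
have relentE : relent rho sigma =
  ((\sum_(i < n) (if p i == 0 then 0 else p i * ln (p i)))%R%:E
   + \sum_(i < n) \sum_(j < n)
       (if (p i * w i j)%R == 0%R then 0%E
        else if q j == 0%R then +oo%E else (- (p i * w i j * ln (q j))%R)%:E))%E by [].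
rewrite relentE {relentE}.
set T := fun i j => p i * w i j * (- ln (p i) - ln a - ln (1 + lam^-1) + 1 + (lam + 1)^-1)
    - a^-1 * (w i j * (lam * p i * q j / (lam * p i + q j)))
    - (lam + 1)^-1 * (q j * w i j).
have -> : \sum_(i < n) (if p i == 0 then 0 else p i * ln (p i)) =
    \sum_i p i * ln (p i).
  by apply: eq_bigr => i _; case: eqVneq => // ->; rewrite mul0r.
apply: le_trans (_ : ((\sum_i p i * ln (p i))%R%:E + \sum_i \sum_j (T i j)%:E <= _)%E);
  last first.
  apply: leeD => //; apply: lee_sum => i _; apply: lee_sum => j _.
  exact: relent_term_ge.
have sE i : (\sum_j (T i j)%:E = (\sum_j T i j)%R%:E)%E by rewrite sumEFin.
rewrite [X in (_ + X)%E](eq_bigr _ (fun i _ => sE i)).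
rewrite sumEFin -EFinD lee_fin.
set K := - ln a - ln (1 + lam^-1) + 1 + (lam + 1)^-1.
have -> : \sum_i \sum_j T i j = - \sum_i p i * ln (p i) + K
   - a^-1 * (\sum_i \sum_j w i j * (lam * p i * q j / (lam * p i + q j)))
   - (lam + 1)^-1.
  have -> : \sum_i \sum_j T i j = \sum_i \sum_j p i * w i j * (K - ln (p i))
      - \sum_i \sum_j a^-1 * (w i j * (lam * p i * q j / (lam * p i + q j)))
      - \sum_i \sum_j (lam + 1)^-1 * (q j * w i j).
    rewrite -!sumrB; apply: eq_bigr => i _; rewrite -!sumrB; apply: eq_bigr => j _.
    by rewrite /T; congr (_ * _ - _ - _); rewrite /K; lra.
  congr (_ - _ - _).
  - transitivity (\sum_i (K * p i - p i * ln (p i))).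
      apply: eq_bigr => i _; rewrite -mulr_suml -mulr_sumr sum_w_row mulr1.
      by rewrite mulrBr [p i * K]mulrC.
    by rewrite sumrB -mulr_sumr sum_specval // mulr1 addrC.
  - by rewrite mulr_sumr; apply: eq_bigr => i _; rewrite mulr_sumr.
  - rewrite exchange_big /=.
    under eq_bigr do rewrite -mulr_sumr -mulr_sumr sum_w_col mulr1.
    by rewrite -mulr_sumr sum_specval // mulr1.
have : a^-1 * (\sum_i \sum_j w i j * (lam * p i * q j / (lam * p i + q j))) <= 1.
  by rewrite ler_pdivrMl // mulr1.
rewrite /K; lra.
Qed.

End Test.
End RelativeEntropy.

(** * Cauchy-Schwarz bounds for traces and for two overlapping maximally entangled tests *)

Section TraceBounds.
Variable R : realType.
Local Notation C := (R[i]).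

Lemma cauchy_schwarz_sum (T : finType) (x y : T -> C) :
  `|\sum_t x t * y t| ^+ 2 <= (\sum_t `|x t| ^+ 2) * (\sum_t `|y t| ^+ 2).
Proof.
pose u : 'rV[C]_#|T| := \row_i x (enum_val i).
(* The conjugate cancels the one that [dotmx] puts on its second argument. *)
pose v : 'rV[C]_#|T| := \row_i (y (enum_val i))^*.
have [+ _] := CauchySchwarz (@dotmx C #|T|) u v.
rewrite -[X in `|X| ^+ 2]/(dotmx u v) -[X in X * _]/(dotmx u u) -[X in _ * X]/(dotmx v v).
rewrite !dotmxE !mxE.
rewrite (reindex (@enum_val T T)) /=; last exact/onW_bij/enum_val_bij.
rewrite [\sum_t `|x t| ^+ 2](reindex (@enum_val T T)) /=; last exact/onW_bij/enum_val_bij.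
rewrite [\sum_t `|y t| ^+ 2](reindex (@enum_val T T)) /=; last exact/onW_bij/enum_val_bij.
congr (`|_| ^+ 2 <= _ * _); apply: eq_bigr => i _.
- by rewrite !mxE conjCK.
- by rewrite !mxE normCK.
- by rewrite !mxE normCK conjCK mulrC.
Qed.

Lemma trace_mul_cauchy m n (A : 'M[C]_(m, n)) (B : 'M[C]_(n, m)) :
  `|\tr (A *m B)| ^+ 2 <= \tr (dag A *m A) * \tr (dag B *m B).
Proof.
have -> : \tr (A *m B) = \sum_(t : 'I_m * 'I_n) A t.1 t.2 * B t.2 t.1.
  rewrite -(pair_bigA _ (fun i j => A i j * B j i)) /=.
  by apply: eq_bigr => i _; rewrite mxE.
rewrite !trace_dag_mulmx [X in _ <= X * _]exchange_big /=.
by rewrite !pair_big /=; apply: cauchy_schwarz_sum.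
Qed.

(** A projector P of trace at most d that fixes the columns of A satisfies Tr(A Y) = Tr(P A Y), so
    Cauchy-Schwarz costs only the factor Tr P. The inner dimension d thus replaces the outer one,
    m. *)
Lemma trace_factor_le m d (A : 'M[C]_(m, d)) (Y : 'M[C]_(d, m)) :
  `|\tr (A *m Y)| ^+ 2 <= d%:R * \sum_i \sum_j `|(A *m Y) i j| ^+ 2.
Proof.
suff [P [PA PP trP]] : exists P : 'M[C]_m,
    [/\ P *m A = A, dag P *m P = P & \tr P <= d%:R].
  rewrite -{1}PA -mulmxA; apply: le_trans (trace_mul_cauchy _ _) _.
  rewrite PP [X in _ <= _ * X]exchange_big /= -trace_dag_mulmx.
  by apply: ler_wpM2r trP; apply/psd_trace_ge0/gram_psd.
(* For m < d the identity serves as P. Otherwise Gram-Schmidt on the d rows of [A^T], possible since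
   d <= m, gives an orthonormal family whose span contains them. *)
have [dm|md] := leqP d m; last first.
  by exists 1%:M; rewrite dag1 !mul1mx mxtrace1 ler_nat ltnW.
pose B := schmidt A^T.
have BB : B *m dag B = 1%:M by apply/unitarymxP/schmidt_unitarymx.
have [D AD] : exists D, A^T = D *m B by apply/submxP/schmidt_sub.
have AE : A = B^T *m D^T by rewrite -trmx_mul -AD trmxK.
have QQ : dag B^T *m B^T = 1%:M.
  apply: trmx_inj; rewrite trmx_mul trmxK trmx1 -[RHS]BB.
  by congr (_ *m _); apply/matrixP => i j; rewrite !mxE.
exists (B^T *m dag B^T); split.
- by rewrite {1}AE mulmxA -(mulmxA _ _ B^T) QQ mulmx1 -AE.
- by rewrite dagM dagK mulmxA -(mulmxA _ _ B^T) QQ mulmx1.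
- by rewrite mxtrace_mulC QQ mxtrace1.
Qed.

(* Compare x with y_abc = [a = b] P_c + [a = c] Q_b, the adjoint of the pair of
   contractions (P, Q) applied to their own value: <y, x> = |P|^2 + |Q|^2 and
   |y|^2 <= (m + 1) (|P|^2 + |Q|^2). *)
Lemma maxent_overlap m (x : 'I_m -> 'I_m -> 'I_m -> C) :
  \sum_c `|\sum_a x a a c| ^+ 2 + \sum_b `|\sum_a x a b a| ^+ 2 <=
  m.+1%:R * \sum_a \sum_b \sum_c `|x a b c| ^+ 2.
Proof.
pose P c := \sum_a x a a c; pose Q b := \sum_a x a b a.
rewrite -/(P _) -/(Q _).
set s := (X in X <= _); set N := \sum_a _.
pose y a b c := (a == b)%:R * P c + (a == c)%:R * Q b.
pose k : C := m.+1%:R.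
have sumd (F : 'I_m -> C) a : \sum_b (a == b)%:R * F b = F a.
  rewrite (bigD1 a) //= eqxx mul1r big1 ?addr0 // => b ba.
  by rewrite eq_sym (negPf ba) mul0r.
have sE : \sum_a \sum_b \sum_c x a b c * (y a b c)^* = s.
  rewrite /s.
  transitivity (\sum_a (\sum_c x a a c * (P c)^* + \sum_b x a b a * (Q b)^*)).
    apply: eq_bigr => a _.
    transitivity (\sum_b ((a == b)%:R * (\sum_c x a b c * (P c)^*)
                   + x a b a * (Q b)^*)).
      apply: eq_bigr => b _.
      rewrite -(sumd (fun c => x a b c * (Q b)^*) a) mulr_sumr -big_split /=.
      apply: eq_bigr => c _.
      by rewrite /y rmorphD !rmorphM /= !rmorph_nat; ring.
    by rewrite big_split /= sumd.
  rewrite big_split /= exchange_big [X in _ + X]exchange_big /=.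
  congr (_ + _); apply: eq_bigr => c _; by rewrite -mulr_suml normCK.
have yE : \sum_a \sum_b \sum_c `|y a b c| ^+ 2 <= k * s.
  have -> : \sum_a \sum_b \sum_c `|y a b c| ^+ 2 =
      m%:R * s + \sum_a (P a * (Q a)^* + (P a)^* * Q a).
    transitivity (\sum_(a < m) (\sum_c `|P c| ^+ 2 + (\sum_b `|Q b| ^+ 2
        + (P a * (Q a)^* + (P a)^* * Q a)))).
      apply: eq_bigr => a _.
      transitivity (\sum_b ((a == b)%:R * (\sum_c `|P c| ^+ 2)
        + (`|Q b| ^+ 2 + (a == b)%:R * (P a * (Q b)^* + (P a)^* * Q b)))).
        apply: eq_bigr => b _.
        rewrite -(sumd (fun c => `|Q b| ^+ 2
          + (a == b)%:R * (P c * (Q b)^* + (P c)^* * Q b)) a).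
        rewrite mulr_sumr -big_split /=; apply: eq_bigr => c _.
        rewrite /y !normCK rmorphD !rmorphM /= !rmorph_nat.
        by case: eqP => _; case: eqP => _;
          rewrite ?mul0r ?mul1r ?addr0 ?add0r ?mulr0; ring.
      by rewrite big_split /= sumd big_split /= sumd.
    rewrite big_split /= [X in _ + X]big_split /= !sumr_const !card_ord.
    by rewrite addrA -mulrnDl mulr_natl.
  rewrite /k -natr1 mulrDl mul1r lerD2l /s -big_split /=.
  apply: ler_sum => a _.
  rewrite -/(P a) -/(Q a); move: (P a) (Q a) => u v.
  have : 0 <= `|u - v| ^+ 2 by rewrite exprn_ge0.
  rewrite -[_ + _ <= _]subr_ge0 !normCK rmorphB /=.
  by congr (0 <= _); rewrite /=; ring.
(* Expanding |k x - y|^2 with k = m + 1 gives k^2 N - 2 k s + |y|^2 <= k (k N - s), which proves s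
   <= k N without dividing by s. *)
have h0 : 0 <= \sum_a \sum_b \sum_c `|k * x a b c - y a b c| ^+ 2.
  by do 3! (apply: sumr_ge0 => ? _); rewrite exprn_ge0.
have kr : k^* = k by rewrite rmorph_nat.
have sr : s^* = s.
  by rewrite geC0_conj // addr_ge0 // sumr_ge0 // => ? _; rewrite exprn_ge0.
have h1 : \sum_a \sum_b \sum_c `|k * x a b c - y a b c| ^+ 2 =
   k ^+ 2 * N - k * s - k * s^* + \sum_a \sum_b \sum_c `|y a b c| ^+ 2.
  rewrite -{2}sE !rmorph_sum /N -sE !mulr_sumr -!sumrB -big_split /=.
  apply: eq_bigr => a _; rewrite rmorph_sum !mulr_sumr -!sumrB -big_split /=.
  apply: eq_bigr => b _; rewrite rmorph_sum !mulr_sumr -!sumrB -big_split /=.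
  apply: eq_bigr => c _; rewrite !normCK rmorphB !rmorphM /= conjCK kr; ring.
have k0 : 0 < k by rewrite ltr0n.
rewrite -subr_ge0 -(pmulr_rge0 _ k0); apply: le_trans h0 _.
rewrite h1 sr -subr_ge0; move: yE; rewrite -subr_ge0.
by congr (0 <= _); ring.
Qed.

End TraceBounds.

(** * Pairing of basis indices *)

Section Indices.

Lemma pidx_fst m n (a : 'I_m) (b : 'I_n) : fstI (pidx a b) = a.
Proof.
by apply: val_inj; rewrite /= divnMDl ?divn_small ?addn0 // (leq_ltn_trans _ (ltn_ord b)).
Qed.

Lemma pidx_snd m n (a : 'I_m) (b : 'I_n) : sndI (pidx a b) = b.
Proof. by apply: val_inj; rewrite /= modnMDl modn_small. Qed.

Lemma pidxK m n (i : 'I_(m * n)) : pidx (fstI i) (sndI i) = i.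
Proof. by apply: val_inj; rewrite /= -divn_eq. Qed.

Lemma sum_pidx (V : nmodType) m n (F : 'I_(m * n) -> V) :
  \sum_i F i = \sum_a \sum_b F (pidx a b).
Proof.
rewrite pair_big /= (reindex (fun t : 'I_m * 'I_n => pidx t.1 t.2)) //=.
exists (fun i => (fstI i, sndI i)) => [[a b] _|i _] /=; last exact: pidxK.
by rewrite pidx_fst pidx_snd.
Qed.

End Indices.

(** * The test obtained from a one-way protocol, and its expectation values *)

Section OneWayTest.
Variable R : realType.
Local Notation C := (R[i]).
Local Notation "x %:C" := (real_complex R x).
Variables (m d : nat) (S L : finType).
(** The outcome s combines the message with the index of Alice's Kraus operator. Alice's operators
    are only assumed subnormalized, because zero padding destroys their completeness; Bob's must
    form a channel for every s. *)
Variables (A : S -> 'M[C]_(m, d)) (B : S -> L -> 'M[C]_(m, d)).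
Hypothesis m_gt0 : (0 < m)%N.
Hypothesis A_sub : forall v : 'I_d -> C,
  \sum_s \sum_i `|\sum_j A s i j * v j| ^+ 2 <= \sum_j `|v j| ^+ 2.
Hypothesis B_complete : forall s (v : 'I_d -> C),
  \sum_l \sum_i `|\sum_j B s l i j * v j| ^+ 2 = \sum_j `|v j| ^+ 2.

(* The row sum_i <i i| (A_s (x) B_sl), i.e. <Phi_m| pulled back, times sqrt m. *)
Definition pullback s l : 'rV[C]_(d * d) :=
  \row_x \sum_i A s i (fstI x) * B s l i (sndI x).

Lemma sum_pullback s l (x : 'I_d -> 'I_d -> C) :
  \sum_a \sum_b pullback s l 0 (pidx a b) * x a b =
  \sum_i \sum_b B s l i b * (\sum_a A s i a * x a b).
Proof.
under eq_bigr do under eq_bigr do rewrite mxE pidx_fst pidx_snd mulr_suml.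
under eq_bigr do rewrite exchange_big /=.
rewrite exchange_big /=; apply: eq_bigr => i _.
rewrite exchange_big /=; apply: eq_bigr => b _.
by rewrite mulr_sumr; apply: eq_bigr => a _; rewrite mulrAC mulrC.
Qed.

(** The amplitude is the trace of the m by m matrix A_s X B_sl^T. Factoring it through dimension m
    (identity times the whole) or through dimension d (A_s times the rest) gives the two values of
    k: the first makes the test at most 1, the second bounds the fidelity by d / m. *)
Lemma pullback_norm_le k (x : 'I_d -> 'I_d -> C) :
  (k = m \/ k = d) ->
  \sum_s \sum_l `|\sum_a \sum_b pullback s l 0 (pidx a b) * x a b| ^+ 2 <=
  k%:R * \sum_a \sum_b `|x a b| ^+ 2.
Proof.
move=> hk.
pose z s l i b := \sum_b' B s l b b' * (\sum_a A s i a * x a b').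
have zE s l : `|\sum_a \sum_b pullback s l 0 (pidx a b) * x a b| ^+ 2 <=
    k%:R * \sum_i \sum_b `|z s l i b| ^+ 2.
  rewrite sum_pullback.
  pose X : 'M[C]_(d, d) := \matrix_(a, b) x a b.
  have zM i b : z s l i b = (A s *m (X *m (B s l)^T)) i b.
    rewrite mulmxA mxE; apply: eq_bigr => b' _; rewrite !mxE mulrC; congr (_ * _).
    by apply: eq_bigr => a _; rewrite mxE.
  have -> : \sum_i \sum_b B s l i b * (\sum_a A s i a * x a b) =
     \tr (A s *m (X *m (B s l)^T)) by apply: eq_bigr => i _; rewrite -zM.
  under [X in _ <= _ * X]eq_bigr do under eq_bigr do rewrite zM.
  case: hk => ->; last exact: trace_factor_le.
  by have := trace_factor_le 1%:M (A s *m (X *m (B s l)^T)); rewrite mul1mx.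
apply: le_trans (_ : k%:R * \sum_s \sum_l \sum_i \sum_b `|z s l i b| ^+ 2 <= _).
  rewrite mulr_sumr; apply: ler_sum => s _; rewrite mulr_sumr; exact: ler_sum.
apply: ler_wpM2l; first exact: ler0n.
apply: le_trans (_ : \sum_s \sum_i \sum_b `|\sum_a A s i a * x a b| ^+ 2 <= _).
  apply: ler_sum => s _; rewrite exchange_big /=; apply: ler_sum => i _.
  by rewrite /z B_complete.
under eq_bigr do rewrite exchange_big /=.
rewrite exchange_big /= [X in _ <= X]exchange_big /=.
by apply: ler_sum => b _; exact: A_sub.
Qed.

(** Bob's channel for the outcome s is also applied to the idle copy of B, which preserves norms by
    completeness; then [maxent_overlap] applies for each s, l, l'. One-way communication matters
    here: both copies are processed with the same s, so a single measurement by Alice serves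
    both. *)
Lemma pullback_pair_norm_le (x : 'I_d -> 'I_d -> 'I_d -> C) :
  \sum_s \sum_l \sum_c `|\sum_a \sum_b pullback s l 0 (pidx a b) * x a b c| ^+ 2 +
  \sum_s \sum_l \sum_b `|\sum_a \sum_c pullback s l 0 (pidx a c) * x a b c| ^+ 2 <=
  m.+1%:R * \sum_a \sum_b \sum_c `|x a b c| ^+ 2.
Proof.
pose z s l l' i b c := \sum_b' B s l b b' *
  (\sum_c' B s l' c c' * (\sum_a A s i a * x a b' c')).
have -> : \sum_s \sum_l \sum_c `|\sum_a \sum_b pullback s l 0 (pidx a b) * x a b c| ^+ 2
    = \sum_s \sum_l \sum_l' \sum_c `|\sum_i z s l l' i i c| ^+ 2.
  apply: eq_bigr => s _; apply: eq_bigr => l _; rewrite -(B_complete s).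
  apply: eq_bigr => l' _; apply: eq_bigr => c _; congr (`|_| ^+ 2) => /=.
  under eq_bigr do rewrite sum_pullback mulr_sumr.
  rewrite exchange_big /=; apply: eq_bigr => i _.
  under eq_bigr do rewrite mulr_sumr.
  rewrite exchange_big /=; apply: eq_bigr => b _.
  by rewrite mulr_sumr; apply: eq_bigr => c' _; rewrite mulrCA.
have -> : \sum_s \sum_l \sum_b `|\sum_a \sum_c pullback s l 0 (pidx a c) * x a b c| ^+ 2
    = \sum_s \sum_l \sum_l' \sum_b `|\sum_i z s l l' i b i| ^+ 2.
  apply: eq_bigr => s _; rewrite [RHS]exchange_big; apply: eq_bigr => l' _ /=.
  rewrite -(B_complete s).
  apply: eq_bigr => l _; apply: eq_bigr => b _; congr (`|_| ^+ 2) => /=.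
  under eq_bigr do rewrite sum_pullback mulr_sumr.
  rewrite exchange_big /=; apply: eq_bigr => i _.
  by apply: eq_bigr => b' _.
apply: le_trans (_ : m.+1%:R *
    \sum_s \sum_l \sum_l' \sum_i \sum_b \sum_c `|z s l l' i b c| ^+ 2 <= _).
  rewrite -big_split mulr_sumr; apply: ler_sum => s _ /=.
  rewrite -big_split mulr_sumr; apply: ler_sum => l _ /=.
  rewrite -big_split mulr_sumr; apply: ler_sum => l' _ /=.
  exact: maxent_overlap.
apply: ler_wpM2l; first exact: ler0n.
apply: le_trans (_ : \sum_s \sum_i \sum_b \sum_c
    `|\sum_a A s i a * x a b c| ^+ 2 <= _).
  apply: ler_sum => s _.
  apply: le_trans (_ : \sum_l' \sum_i \sum_b' \sum_c
      `|\sum_c' B s l' c c' * (\sum_a A s i a * x a b' c')| ^+ 2 <= _).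
    rewrite exchange_big /=; apply: ler_sum => l' _.
    rewrite exchange_big /=; apply: ler_sum => i _.
    under eq_bigr do rewrite exchange_big /=.
    rewrite exchange_big /= [X in _ <= X]exchange_big /=; apply: ler_sum => c _.
    by rewrite /z B_complete.
  rewrite exchange_big /=; apply: ler_sum => i _.
  rewrite exchange_big /=; apply: ler_sum => b _.
  by rewrite B_complete.
under eq_bigr do rewrite exchange_big /=.
rewrite exchange_big /= [X in _ <= X]exchange_big /=; apply: ler_sum => b _.
under eq_bigr do rewrite exchange_big /=.
rewrite exchange_big /= [X in _ <= X]exchange_big /=; apply: ler_sum => c _.
exact: A_sub.
Qed.

(** The adjoint of the protocol applied to the projector on |Phi_m>. *)
Definition test_effect : 'M[C]_(d * d) :=
  (m%:R^-1) *: \sum_s \sum_l dag (pullback s l) *m pullback s l.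

Lemma trace_test_effect (X : 'M[C]_(d * d)) :
  \tr (X *m test_effect) =
  m%:R^-1 * \sum_s \sum_l (pullback s l *m X *m dag (pullback s l)) 0 0.
Proof.
rewrite -scalemxAr mxtraceZ; congr (_ * _); rewrite mulmx_sumr raddf_sum /=.
apply: eq_bigr => s _; rewrite mulmx_sumr raddf_sum /=; apply: eq_bigr => l _.
by rewrite mulmxA mxtrace_mulC mulmxA trace_mx11.
Qed.

Lemma test_effect_psd : psd test_effect.
Proof.
move=> v; rewrite -trace_mx11 -mulmxA mxtrace_mulC -mulmxA mxtrace_mulC.
rewrite trace_test_effect mulr_ge0 ?invr_ge0 ?ler0n //.
apply: sumr_ge0 => s _; apply: sumr_ge0 => l _.
have -> : pullback s l *m (v *m dag v) *m dag (pullback s l) =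
   (pullback s l *m v) *m dag (pullback s l *m v) by rewrite dagM !mulmxA.
by rewrite mulmx_dag_entry sumr_ge0 // => ? _; rewrite exprn_ge0.
Qed.

(** The conjugated rows of Y are unnormalized pure states whose mixture is Y^* Y, and the vector
    bound applies to each. *)
Lemma pullback_gram k q (Y : 'M[C]_(q, d * d)) : (k = m \/ k = d) ->
  \sum_s \sum_l (pullback s l *m (dag Y *m Y) *m dag (pullback s l)) 0 0 <=
  k%:R * \tr (dag Y *m Y).
Proof.
move=> hk; rewrite trace_dag_mulmx [X in _ <= _ * X]exchange_big /= mulr_sumr.
have -> : \sum_s \sum_l (pullback s l *m (dag Y *m Y) *m dag (pullback s l)) 0 0 =
  \sum_r \sum_s \sum_l
    `|\sum_a \sum_b pullback s l 0 (pidx a b) * (Y r (pidx a b))^*| ^+ 2.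
  rewrite [RHS]exchange_big; apply: eq_bigr => s _ /=.
  rewrite [RHS]exchange_big; apply: eq_bigr => l _ /=.
  have -> : pullback s l *m (dag Y *m Y) *m dag (pullback s l) =
     (pullback s l *m dag Y) *m dag (pullback s l *m dag Y) by rewrite dagM dagK !mulmxA.
  rewrite mulmx_dag_entry; apply: eq_bigr => r _; congr (`|_| ^+ 2).
  rewrite mxE sum_pidx; apply: eq_bigr => a _; apply: eq_bigr => b _.
  by rewrite dagE.
apply: ler_sum => r _.
apply: le_trans (pullback_norm_le (fun a b => (Y r (pidx a b))^*) hk) _.
rewrite sum_pidx; apply: ler_wpM2l; first exact: ler0n.
by apply: ler_sum => a _; apply: ler_sum => b _; rewrite norm_conjC.
Qed.

Lemma trace_test_effect_le k r (Y : 'M[C]_(r, d * d)) : (k = m \/ k = d) ->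
  \tr (dag Y *m Y *m test_effect) <= k%:R / m%:R * \tr (dag Y *m Y).
Proof.
move=> hk; rewrite trace_test_effect mulrAC [_ / _]mulrC.
by apply: ler_wpM2l (pullback_gram _ hk); rewrite invr_ge0 ler0n.
Qed.

(** The case k = m of the trace bound, for the rank-one operator v v^*. *)
Lemma test_effect_compl_psd : psd (1%:M - test_effect).
Proof.
move=> v; rewrite -trace_mx11 -mulmxA mxtrace_mulC.
rewrite mulmxBl mul1mx mulmxBl raddfB /= subr_ge0 -mulmxA mxtrace_mulC.
have := trace_test_effect_le (dag v) (or_introl erefl).
by rewrite dagK divff ?mul1r // pnatr_eq0 -lt0n.
Qed.

Lemma trace_test_effect_density (rho : 'M[C]_(d * d)) : density rho ->
  \tr (rho *m test_effect) <= d%:R / m%:R.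
Proof.
move=> [/psd_gram [Y ->] trY].
by have := trace_test_effect_le Y (or_intror erefl); rewrite trY mulr1.
Qed.

(* The average of the tests on AB and on AB' has the same expectation in the
   symmetric extension, and its norm is at most (m + 1) / (2 m). *)
Lemma trace_test_effect_sym_extendible (sigma : 'M[C]_(d * d)) :
  sym_extendible sigma ->
  \tr (sigma *m test_effect) <= m.+1%:R / (2 * m%:R).
Proof.
move=> [_ [T [[/psd_gram [Y TE] trT] Tswap <-]]].
pose x r a b c := (Y r (pidx (pidx a b) c))^*.
have trx : \sum_r \sum_a \sum_b \sum_c `|x r a b c| ^+ 2 = 1.
  rewrite -trT TE trace_dag_mulmx [RHS]exchange_big /=; apply: eq_bigr => r _.
  rewrite !sum_pidx; apply: eq_bigr => a _; apply: eq_bigr => b _.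
  by apply: eq_bigr => c _; rewrite norm_conjC.
have T_AB a b c a' b' : T (pidx (pidx a b) c) (pidx (pidx a' b') c) =
    \sum_r x r a b c * (x r a' b' c)^*.
  by rewrite TE mxE; apply: eq_bigr => r _; rewrite dagE conjCK.
(* Swap invariance yields a second expansion of the same entries, with the roles of B and B'
   exchanged; each expansion gives one of the two sums in [pullback_pair_norm_le]. *)
have T_AB' a b c a' b' : T (pidx (pidx a b) c) (pidx (pidx a' b') c) =
    \sum_r x r a c b * (x r a' c b')^*.
  rewrite -Tswap /swapBB' !(pidx_fst, pidx_snd) TE mxE.
  by apply: eq_bigr => r _; rewrite dagE conjCK.
have expand s l (f : 'I_d -> 'I_d -> 'I_d -> 'I_(d * d * d) -> C) :
    (forall a b c a' b', T (pidx (pidx a b) c) (pidx (pidx a' b') c) =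
       \sum_r f a b c r * (f a' b' c r)^*) ->
    (pullback s l *m ptraceB' T *m dag (pullback s l)) 0 0 =
    \sum_r \sum_c `|\sum_a \sum_b pullback s l 0 (pidx a b) * f a b c r| ^+ 2.
  move=> Tf; move: (pullback s l) => g.
  have -> : (g *m ptraceB' T *m dag g) 0 0 =
     \sum_y \sum_x \sum_c g 0 x * T (pidx x c) (pidx y c) * (g 0 y)^*.
    rewrite mxE; apply: eq_bigr => y _; rewrite mxE dagE mulr_suml.
    apply: eq_bigr => z _; rewrite mxE mulr_sumr mulr_suml.
    by apply: eq_bigr => c _.
  transitivity (\sum_y \sum_x \sum_c \sum_r (g 0 x * f (fstI x) (sndI x) c r) *
     (g 0 y * f (fstI y) (sndI y) c r)^*).
    apply: eq_bigr => y _; apply: eq_bigr => z _; apply: eq_bigr => c _.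
    have := Tf (fstI z) (sndI z) c (fstI y) (sndI y); rewrite !pidxK => ->.
    rewrite mulr_sumr mulr_suml.
    by apply: eq_bigr => r _; rewrite rmorphM /=; ring.
  under eq_bigr do rewrite exchange_big /=.
  rewrite exchange_big [RHS]exchange_big /=; apply: eq_bigr => c _.
  under eq_bigr do rewrite exchange_big /=.
  rewrite exchange_big /=; apply: eq_bigr => r _.
  have -> : \sum_a \sum_b g 0 (pidx a b) * f a b c r =
      \sum_z g 0 z * f (fstI z) (sndI z) c r.
    rewrite sum_pidx; apply: eq_bigr => a _; apply: eq_bigr => b _.
    by rewrite pidx_fst pidx_snd.
  rewrite normCK rmorph_sum mulr_sumr; apply: eq_bigr => y _.
  by rewrite mulr_suml.
have tot1 : \sum_s \sum_l (pullback s l *m ptraceB' T *m dag (pullback s l)) 0 0 =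
    \sum_r \sum_s \sum_l \sum_c
      `|\sum_a \sum_b pullback s l 0 (pidx a b) * x r a b c| ^+ 2.
  rewrite [RHS]exchange_big; apply: eq_bigr => s _ /=.
  rewrite [RHS]exchange_big; apply: eq_bigr => l _ /=.
  exact: (expand s l (fun a b c r => x r a b c)).
have tot2 : \sum_s \sum_l (pullback s l *m ptraceB' T *m dag (pullback s l)) 0 0 =
    \sum_r \sum_s \sum_l \sum_b
      `|\sum_a \sum_c pullback s l 0 (pidx a c) * x r a b c| ^+ 2.
  rewrite [RHS]exchange_big; apply: eq_bigr => s _ /=.
  rewrite [RHS]exchange_big; apply: eq_bigr => l _ /=.
  exact: (expand s l (fun a b c r => x r a c b)).
rewrite trace_test_effect invfM mulrA [X in X <= _]mulrC ler_pM2r ?invr_gt0 ?ltr0n //.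
have two : 0 < (2 : C) by rewrite ltr0n.
rewrite ler_pdivlMr // mulr2n mulrDr mulr1 {1}tot1 tot2.
rewrite -big_split /= -(mulr1 m.+1%:R) -[X in _ <= _ * X]trx mulr_sumr.
by apply: ler_sum => r _; exact: pullback_pair_norm_le.
Qed.

Section Bounds.
Variables (rho sigma : 'M[C]_(d * d)) (f : R).
Hypotheses (drho : density rho) (fE : f%:C = \tr (rho *m test_effect)).

Lemma test_fidelity_le : f <= d%:R / m%:R.
Proof.
rewrite -lecR fE; apply: le_trans (trace_test_effect_density drho) _.
by rewrite fmorph_div /= !rmorph_nat.
Qed.

Lemma test_fidelity_le1 : f <= 1.
Proof.
rewrite -lecR fE rmorph1 -subr_ge0.
case: drho => hrho <-; rewrite -{1}(mulmx1 rho) -raddfB -mulmxBr.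
by apply: psd_trace_mul_ge0 => //; apply: test_effect_compl_psd.
Qed.

Lemma relent_ge_sym_extendible (lam : R) : sym_extendible sigma -> 0 < lam ->
  ((- ln (lam * (1 - f) + m.+1%:R / (2 * m%:R)) - ln (1 + lam^-1))%:E
    <= relent rho sigma)%E.
Proof.
move=> hs lam0.
have f1 := test_fidelity_le1.
have q0 : 0 < (m.+1%:R / (2 * m%:R) : R) by rewrite divr_gt0 ?mulr_gt0 ?ltr0n.
apply: (relent_ge_test drho hs.1 test_effect_psd test_effect_compl_psd) => //.
  by rewrite ltr_wpDl // mulr_ge0 ?subr_ge0 // ltW.
rewrite rmorphD rmorphM rmorphB rmorph1 /= lerD //.
  rewrite mulmxBr mulmx1 raddfB /= drho.2 fE; exact: lexx.
rewrite fmorph_div rmorphM /= !rmorph_nat.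
exact: trace_test_effect_sym_extendible.
Qed.

End Bounds.

End OneWayTest.

(** * Embedding into equal local dimensions and padding of Kraus operators *)

Section Embedding.
Variable R : realType.
Local Notation C := (R[i]).
Local Notation "x %:C" := (real_complex R x).
Variables dA dB : nat.
Local Notation d := (maxn dA dB).

Definition inject (x : 'I_(dA * dB)) : 'I_(d * d) :=
  pidx (widen_ord (leq_maxl dA dB) (fstI x)) (widen_ord (leq_maxr dA dB) (sndI x)).

Definition project (i : 'I_(d * d)) : option 'I_(dA * dB) :=
  match (insub (val (fstI i)) : option 'I_dA), (insub (val (sndI i)) : option 'I_dB) with
  | Some a, Some b => Some (pidx a b)
  | _, _ => None
  end.

Lemma insub_widen n k (h : (n <= k)%N) (a : 'I_n) :
  insub (val (widen_ord h a)) = Some a.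
Proof. exact: (valK a). Qed.

Lemma project_eq i x : (project i == Some x) = (i == inject x).
Proof.
apply/eqP/eqP => [|->]; last first.
  by rewrite /project !(pidx_fst, pidx_snd) !insub_widen pidxK.
rewrite /project; case: insubP => // a _ ea; case: insubP => // b _ eb [<-].
rewrite -(pidxK i) /inject pidx_fst pidx_snd.
by congr pidx; apply: val_inj.
Qed.

Definition inject_mx : 'M[C]_(d * d, dA * dB) := \matrix_(i, x) (i == inject x)%:R.

Lemma inject_mx_isometry : dag inject_mx *m inject_mx = 1%:M.
Proof.
apply/matrixP => x y; rewrite !mxE (bigD1 (inject x)) //= big1 ?addr0.
  rewrite dagE !mxE eqxx rmorph1 mul1r.
  by rewrite -!project_eq (eqP (_ : project _ == Some x)) ?project_eq.
by move=> i ix; rewrite dagE mxE (negPf ix) rmorph0 mul0r.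
Qed.

Lemma mul_inject_mx k (G : 'M[C]_(k, d * d)) i x :
  (G *m inject_mx) i x = G i (inject x).
Proof.
rewrite mxE (bigD1 (inject x)) //= mxE eqxx mulr1 big1 ?addr0 // => j jx.
by rewrite mxE (negPf jx) mulr0.
Qed.

(** Replaces the entrywise case analysis by conjugation with an isometry, from which positivity and
    trace follow at once. *)
Lemma embedE (rho : 'M[C]_(dA * dB)) :
  embed rho = inject_mx *m rho *m dag inject_mx.
Proof.
have sumE (F : 'I_(dA * dB) -> C) i :
    \sum_x (i == inject x)%:R * F x = if project i is Some x then F x else 0.
  under eq_bigr do rewrite -project_eq.
  case: (project i) => [x|]; last by rewrite big1 // => y _; rewrite mul0r.
  rewrite (bigD1 x) //= eqxx mul1r big1 ?addr0 // => y yx.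
  by rewrite (inj_eq Some_inj) eq_sym (negPf yx) mul0r.
apply/matrixP => i j; rewrite mxE [RHS]mxE.
transitivity (\sum_y (j == inject y)%:R * (\sum_x (i == inject x)%:R * rho x y)).
  rewrite sumE /project.
  by case: (insub (val (fstI j)) : option 'I_dA) => [a|];
    case: (insub (val (sndI j)) : option 'I_dB) => [b|];
    rewrite ?sumE /project; case: insub => [a'|] //; case: insub.
apply: eq_bigr => y _; rewrite mulrC dagE [X in _ * X^*]mxE rmorph_nat mxE.
by congr (_ * _); apply: eq_bigr => x _; rewrite mxE.
Qed.

Lemma embed_density (rho : 'M[C]_(dA * dB)) : density rho -> density (embed rho).
Proof.
move=> [hrho trrho]; split.
  by rewrite embedE; have := psd_conj (dag inject_mx) hrho; rewrite dagK.
by rewrite embedE -mulmxA mxtrace_mulC -mulmxA inject_mx_isometry mulmx1.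
Qed.

Section Kraus.
Variables (m : nat) (K J L : nat).
Variables (A : 'I_K -> 'I_J -> 'M[C]_(m, dA)) (B : 'I_K -> 'I_L -> 'M[C]_(m, dB)).
Hypothesis m_gt0 : (0 < m)%N.
Hypothesis A_complete : \sum_(k < K) \sum_(j < J) (dag (A k j) *m A k j) = 1%:M.
Hypothesis B_complete : forall k, \sum_(l < L) (dag (B k l) *m B k l) = 1%:M.

Definition pad_cols n (X : 'M[C]_(m, n)) : 'M[C]_(m, d) :=
  \matrix_(i, a) (if (insub (val a) : option 'I_n) is Some a' then X i a' else 0).

Definition padA (s : 'I_K * 'I_J) : 'M[C]_(m, d) := pad_cols (A s.1 s.2).

(* The operators |0><b| for b >= dB complete Bob's padded Kraus operators to a
   channel on C^d. *)
Definition padB (s : 'I_K * 'I_J) (l : 'I_L + 'I_d) : 'M[C]_(m, d) :=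
  match l with
  | inl l => pad_cols (B s.1 l)
  | inr b => \matrix_(i, j) ((val i == 0%N) && (j == b) && (dB <= b)%N)%:R
  end.

Lemma sum_pad_cols n (h : (n <= d)%N) (X : 'M[C]_(m, n)) i (v : 'I_d -> C) :
  \sum_a pad_cols X i a * v a = \sum_a X i a * v (widen_ord h a).
Proof.
rewrite (bigID (fun a : 'I_d => (a < n)%N)) /= [X in _ + X]big1 ?addr0.
  rewrite (big_ord_narrow h); apply: eq_bigr => a _.
  by rewrite mxE insub_widen.
by move=> a an; rewrite mxE insubN // mul0r.
Qed.

Lemma sum_norm_mulmx n (T : finType) (X : T -> 'M[C]_(m, n)) (v : 'I_n -> C) :
  \sum_t dag (X t) *m X t = 1%:M ->
  \sum_t \sum_i `|\sum_j X t i j * v j| ^+ 2 = \sum_j `|v j| ^+ 2.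
Proof.
move=> hX; pose w : 'cV[C]_n := \col_j v j.
have -> : \sum_j `|v j| ^+ 2 = (dag w *m 1%:M *m w) 0 0.
  by rewrite mulmx1 dag_mulmx_entry; apply: eq_bigr => j _; rewrite mxE.
rewrite -hX mulmx_sumr mulmx_suml summxE; apply: eq_bigr => t _.
rewrite !mulmxA -dagM -mulmxA dag_mulmx_entry; apply: eq_bigr => i _.
by congr (`|_| ^+ 2); rewrite mxE; apply: eq_bigr => j _; rewrite mxE.
Qed.

Lemma padA_sub (v : 'I_d -> C) :
  \sum_s \sum_i `|\sum_j padA s i j * v j| ^+ 2 <= \sum_j `|v j| ^+ 2.
Proof.
have h := leq_maxl dA dB.
under eq_bigr do under eq_bigr do rewrite (sum_pad_cols h).
rewrite (sum_norm_mulmx (X := fun s : 'I_K * 'I_J => A s.1 s.2)); last first.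
  by rewrite -A_complete pair_bigA.
rewrite -(big_ord_narrow (F := fun a => `|v a| ^+ 2) h) /=.
rewrite [X in _ <= X](bigID (fun a : 'I_d => (a < dA)%N)) /= lerDl.
by apply: sumr_ge0 => *; rewrite exprn_ge0.
Qed.

Lemma padB_complete s (v : 'I_d -> C) :
  \sum_l \sum_i `|\sum_j padB s l i j * v j| ^+ 2 = \sum_j `|v j| ^+ 2.
Proof.
have h := leq_maxr dA dB.
rewrite big_sumType /=.
under eq_bigr do under eq_bigr do rewrite (sum_pad_cols h).
rewrite (sum_norm_mulmx (X := fun l => B s.1 l)) //.
rewrite -(big_ord_narrow (F := fun a => `|v a| ^+ 2) h) /=.
rewrite [RHS](bigID (fun a : 'I_d => (a < dB)%N)) /=; congr (_ + _).
rewrite [RHS]big_mkcond; apply: eq_bigr => b _ /=; rewrite -leqNgt.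
rewrite (bigD1 (Ordinal m_gt0)) //= [X in _ + X]big1 ?addr0.
  rewrite (bigD1 b) //= [X in _ + X]big1 ?addr0.
    by rewrite mxE !eqxx /=; case: leqP; rewrite ?mul1r ?mul0r ?normr0 ?expr0n.
  by move=> j jb; rewrite mxE (negPf jb) andbF mul0r.
move=> i i0; rewrite big1 ?normr0 ?expr0n // => j _.
have -> : padB s (inr b) i j = 0; last by rewrite mul0r.
rewrite mxE; case: eqP => // e; case/eqP: i0; exact: val_inj.
Qed.

(** On the range of the embedding the padded operators act as the original ones, and the added
    |0><b| with b >= dB vanish. *)
Lemma trace_test_effect_embed Lam (rho : 'M[C]_(dA * dB)) : density rho ->
  (forall X, Lam X = \sum_(k < K) \sum_(j < J) \sum_(l < L)
            (kron (A k j) (B k l) *m X *m dag (kron (A k j) (B k l)))) ->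
  (fid_maxent (Lam rho))%:C = \tr (embed rho *m test_effect padA padB).
Proof.
move=> drho LamE.
(* [fid_maxent] is a real part, so the complex trace has to be known real. *)
have real_tr : \tr (embed rho *m test_effect padA padB) \is Num.real.
  apply: ger0_real; apply: psd_trace_mul_ge0; first by case: (embed_density drho).
  exact: test_effect_psd.
rewrite -[RHS]RRe_real //; congr (_%:C).
rewrite trace_test_effect /fid_maxent.
(* The row u is sqrt m times <Phi_m|. *)
pose u : 'rV[C]_(m * m) := \sum_a delta_mx 0 (pidx a a).
have uE k (X : 'M[C]_(m * m, k)) j : (u *m X) 0 j = \sum_a X (pidx a a) j.
  rewrite mulmx_suml summxE; apply: eq_bigr => a _.
  by rewrite -rowE mxE.
have uuE (X : 'M[C]_(m * m)) : \sum_a \sum_b X (pidx a a) (pidx b b) =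
    (u *m X *m dag u) 0 0.
  rewrite -mulmxA uE; apply: eq_bigr => a _.
  have -> : X *m dag u = dag (u *m dag X) by rewrite dagM dagK.
  by rewrite dagE uE rmorph_sum; apply: eq_bigr => b _; rewrite /= dagE conjCK.
rewrite uuE.
have -> : (u *m Lam rho *m dag u) 0 0 =
    \sum_s \sum_l (pullback padA padB s l *m embed rho *m dag (pullback padA padB s l)) 0 0.
  rewrite LamE mulmx_sumr mulmx_suml summxE.
  rewrite -(pair_bigA _ (fun k j => \sum_l (pullback padA padB (k, j) l *m
     embed rho *m dag (pullback padA padB (k, j) l)) 0 0)) /=.
  apply: eq_bigr => k _; rewrite mulmx_sumr mulmx_suml summxE.
  apply: eq_bigr => j _; rewrite mulmx_sumr mulmx_suml summxE big_sumType /=.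
  have gE l : pullback padA padB (k, j) l *m embed rho *m
       dag (pullback padA padB (k, j) l) =
      (pullback padA padB (k, j) l *m inject_mx) *m rho *m
       dag (pullback padA padB (k, j) l *m inject_mx).
    by rewrite embedE dagM !mulmxA.
  rewrite [X in _ = _ + X]big1 ?addr0 => [|b _]; last first.
    rewrite gE; have -> : pullback padA padB (k, j) (inr b) *m inject_mx = 0.
      apply/rowP => x; rewrite mul_inject_mx mxE [RHS]mxE big1 // => i _.
      rewrite /inject !(pidx_fst, pidx_snd) [X in _ * X]mxE.
      case: (eqVneq (widen_ord _ (sndI x)) b) => [<-|_]; last by rewrite andbF mulr0.
      rewrite [(dB <= _)%N](_ : _ = false) ?andbF ?mulr0 //.
      by apply/negbTE; rewrite -ltnNge; exact: (ltn_ord (sndI x)).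
    by rewrite !mul0mx mxE.
  apply: eq_bigr => l _; rewrite gE !mulmxA -mulmxA -dagM.
  have -> // : u *m kron (A k j) (B k l) =
      pullback padA padB (k, j) (inl l) *m inject_mx.
  apply/rowP => x; rewrite uE mul_inject_mx mxE; apply: eq_bigr => i _.
  rewrite [LHS]mxE !(pidx_fst, pidx_snd) /inject !mxE.
  by rewrite !insub_widen.
move: (\sum_s _) => z.
have -> : (m%:R^-1 : C) = (m%:R^-1)%:C by rewrite fmorphV rmorph_nat.
by case: z => a b /=; rewrite mul0r subr0 mulrC.
Qed.

End Kraus.

Lemma one_way_LOCC_bounds m (Lam : 'M[C]_(dA * dB) -> 'M[C]_(m * m))
    (rho : 'M[C]_(dA * dB)) :
  (0 < m)%N -> density rho -> one_way_LOCC Lam ->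
  [/\ fid_maxent (Lam rho) <= 1, fid_maxent (Lam rho) <= d%:R / m%:R &
  forall sigma (lam : R), sym_extendible sigma -> 0 < lam ->
   ((- ln (lam * (1 - fid_maxent (Lam rho)) + m.+1%:R / (2 * m%:R))
     - ln (1 + lam^-1))%:E <= relent (embed rho) sigma)%E].
Proof.
move=> m0 drho [K [J [L [A [B [hA hB LamE]]]]]].
have fE := trace_test_effect_embed drho LamE.
have hA' := padA_sub hA; have hB' := @padB_complete m K J L B m0 hB.

split.
- exact: (test_fidelity_le1 m0 hA' hB' (embed_density drho) fE).
- exact: (test_fidelity_le hA' hB' (embed_density drho) fE).
move=> sigma lam hs lam0.
exact: (relent_ge_sym_extendible m0 hA' hB' (embed_density drho) fE hs lam0).
Qed.

End Embedding.

(** * Tensor powers of a state are states *)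

Section TensorPowers.
Variable R : realType.
Local Notation C := (R[i]).

Lemma digits_inj d n (a b : nat) : (a < d ^ n)%N -> (b < d ^ n)%N ->
  (forall k, (k < n)%N -> (a %/ d ^ k) %% d = (b %/ d ^ k) %% d)%N -> a = b.
Proof.
elim: n a b => [|n IHn] a b; first by rewrite !ltnS !leqn0 => /eqP -> /eqP ->.
move=> ha hb hab; have d0 : (0 < d)%N by case: d ha {IHn hb hab}; rewrite // exp0n.
rewrite (divn_eq a d) (divn_eq b d).
have /= := hab 0%N isT; rewrite expn0 !divn1 => ->.
congr (_ * _ + _)%N; apply: IHn; rewrite ?ltn_divLR -?expnSr // => k kn.
by have := hab k.+1 kn; rewrite expnS !divnMA.
Qed.

(** The regrouping of A^n B^n into (AB)^n, under which [tpow] becomes an ordinary tensor power. *)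
Definition local_indices dA dB n (i : 'I_(dA ^ n * dB ^ n)) :
    {ffun 'I_n -> 'I_(dA * dB)} :=
  [ffun k => pidx (digit (fstI i) k) (digit (sndI i) k)].

Lemma digit_inj d n (a b : 'I_(d ^ n)) : digit a =1 digit b -> a = b.
Proof.
move=> ab; apply: val_inj; apply: (digits_inj (ltn_ord a) (ltn_ord b)) => k kn.
exact: (congr1 val (ab (Ordinal kn))).
Qed.

Lemma local_indices_bij dA dB n : bijective (@local_indices dA dB n).
Proof.
apply: inj_card_bij => [i j /ffunP ij|].
  rewrite -(pidxK i) -(pidxK j); congr pidx; apply: digit_inj => k.
    by have := congr1 (@fstI _ _) (ij k); rewrite !ffunE !pidx_fst.
  by have := congr1 (@sndI _ _) (ij k); rewrite !ffunE !pidx_snd.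
by rewrite card_ffun !card_ord expnMn.
Qed.

(** A Gram factor Y of rho gives the Gram factor Y tensored n times, with rows indexed by functions.
    Positivity and the trace Tr(rho)^n both come from distributing a product over sums. *)
Lemma tpow_density dA dB (rho : 'M[C]_(dA * dB)) n :
  density rho -> density (tpow rho n).
Proof.
move=> [/psd_gram [Y rhoE] trrho].
have tpowE i j : tpow rho n i j =
    \prod_k rho (local_indices i k) (local_indices j k).
  by rewrite mxE; apply: eq_bigr => k _; rewrite !ffunE.
split.
  pose T := {ffun 'I_n -> 'I_(dA * dB)}.
  pose Z : 'M[C]_(#|{: T}|, dA ^ n * dB ^ n) :=
    \matrix_(r, j) \prod_k Y ((enum_val r : T) k) (local_indices j k).
  have -> : tpow rho n = dag Z *m Z; last exact: gram_psd.
  apply/matrixP => i j; rewrite tpowE rhoE.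
  under eq_bigr do rewrite mxE.
  rewrite bigA_distr_bigA mxE (reindex (@enum_val T T)) /=; last first.
    exact/onW_bij/enum_val_bij.
  apply: eq_bigr => r _; rewrite dagE !mxE rmorph_prod -big_split /=.
  by apply: eq_bigr => k _; rewrite dagE.
rewrite /mxtrace; under eq_bigr do rewrite tpowE.
have [g gK Kg] := local_indices_bij dA dB n.
rewrite -(reindex (@local_indices dA dB n) (P := predT)
   (F := fun f : {ffun 'I_n -> 'I_(dA * dB)} => \prod_k rho (f k) (f k))) /=; last first.
  by apply: onW_bij; exists g.
rewrite -(bigA_distr_bigA (fun (k : 'I_n) x => rho x x)).
by rewrite big1 // => k _; exact: trrho.
Qed.

End TensorPowers.

(** * Limits of rates and of the regularized divergence *)

Section Asymptotics.
Local Open Scope classical_set_scope.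
Local Open Scope ring_scope.
Variable R : realType.
Local Notation C := (R[i]).

(** The trivial test M = 1 with a = 1 and lam = 1 / e gives the lower bound - ln (1 + e) >= - e. *)
Lemma relent_ge0 n (rho sigma : 'M[C]_n) :
  density rho -> density sigma -> (0 <= relent rho sigma)%E.
Proof.
move=> drho dsigma; apply/lee_addgt0Pr => e e0.
have p1 : psd (1%:M : 'M[C]_n) by rewrite -(mulmx1 1%:M) -{1}dag1; apply: gram_psd.
have p0 : psd (1%:M - 1%:M : 'M[C]_n).
  by move=> v; rewrite subrr mulmx0 mul0mx mxE.
have h : (e^-1)%:C%C * \tr (rho *m (1%:M - 1%:M)) + \tr (sigma *m 1%:M) <=
    (1 : R)%:C%C :> C.
  by rewrite subrr mulmx0 mxtrace0 mulr0 add0r mulmx1 dsigma.2 rmorph1.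
have e1 : 0 < e^-1 by rewrite invr_gt0.
have := relent_ge_test drho dsigma p1 p0 e1 ltr01 h.
rewrite ln1 oppr0 sub0r invrK => h1.
rewrite -leeBlDr // sub0e; apply: le_trans h1.
rewrite lee_fin lerN2 le_ln1Dx //; lra.
Qed.

Lemma limn_esup_ge (u : (\bar R)^nat) (l : \bar R) :
  (\forall n \near \oo, (l <= u n)%E) -> (l <= limn_esup u)%E.
Proof.
move=> hl; rewrite /limn_esup limf_esupE; apply/ereal_infP => _ [V Voo <-].
have [n [Vn ln]] : exists n, V n /\ (l <= u n)%E.
  exact: (@filter_ex _ \oo _ _ (filterI Voo hl)).
by apply: le_trans ln _; apply: ereal_sup_ubound; exists n.
Qed.

(** With x = D^n >= 2 the ratio 2 x / (x + 1) lies between 1 and 2, so the denominator of [delta_d]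
    is positive and at most ln 2. The linear growth in n compensates the division by n in
    [R_E_inf]. *)
Lemma delta_d_ge (D n : nat) : (2 <= D)%N -> (0 < n)%N ->
  n%:R * (ln D%:R / ln 2) <= delta_d R (D ^ n).
Proof.
move=> D2 n0; rewrite /delta_d.
have D0 : 0 < D%:R :> R by rewrite ltr0n; lia.
have Dn : (2 <= (D ^ n)%:R :> R).
  by rewrite ler_nat (leq_trans D2) // -[X in (X <= _)%N]expn1 leq_exp2l.
rewrite {1}natrX lnXn // -[ln D%:R *+ n]mulr_natl mulrA.
set x : R := (D ^ n)%:R in Dn *.
have x1 : 0 < x + 1 by lra.
have f1 : 1 < 2 * x / (x + 1) by rewrite ltr_pdivlMr //; lra.
have f2 : 2 * x / (x + 1) <= 2 by rewrite ler_pdivrMr //; lra.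
apply: ler_wpM2l; first by rewrite mulr_ge0 ?ler0n // ln_ge0 // ler1n; lia.
rewrite lef_pV2 ?posrE ?ln_gt0 // ?ltr1n //.
by rewrite ler_ln ?posrE //; lra.
Qed.

(** This covers d = 1, which occurs at n = 0: both logarithms vanish and the quotient is 0. *)
Lemma delta_d_ge0 d : (0 < d)%N -> 0 <= delta_d R d.
Proof.
move=> d0; have d1 : (1 <= d%:R :> R) by rewrite ler1n.
rewrite /delta_d divr_ge0 ?ln_ge0 // ler_pdivlMr ?mul1r; lra.
Qed.

Lemma maxn_expn a b n : maxn (a ^ n) (b ^ n) = (maxn a b ^ n)%N.
Proof.
case: n => [|n]; first by rewrite !expn0.
by case: (leqP a b) => ab; [apply/maxn_idPr | apply/maxn_idPl]; rewrite leq_exp2r // ltnW.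
Qed.

Section Rate.
Variables (dA dB : nat) (rho : 'M[C]_(dA * dB)).
Local Notation D := (maxn dA dB).
Hypotheses (D_ge2 : (2 <= D)%N) (drho : density rho).

Let dim_gt0 n : (0 < maxn (dA ^ n) (dB ^ n))%N.
Proof. by rewrite maxn_expn expn_gt0; apply/orP; left; lia. Qed.

Lemma R_E_inf_ge0 : (0 <= R_E_inf rho)%E.
Proof.
apply: limn_esup_ge; near=> n; apply: mule_ge0; last first.
  by rewrite lee_fin invr_ge0 ler0n.
apply: mule_ge0; first by rewrite lee_fin delta_d_ge0.
apply/ereal_infP => _ [sigma hs <-]; apply: relent_ge0; last exact: hs.1.
exact/embed_density/tpow_density.
Unshelve. all: by end_near.
Qed.

Section Achieved.
Variables (m : nat -> nat)
  (Lam : forall n : nat, 'M[C]_(dA ^ n * dB ^ n) -> 'M[C]_(m n * m n)) (r : R).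
Hypotheses (m_gt0 : forall n, (0 < m n)%N)
  (hLam : forall n, one_way_LOCC (@Lam n))
  (cvg_fid : (fid_maxent (Lam (tpow rho n)) @[n --> \oo] --> (1 : R))%classic)
  (cvg_rate : (ln ((m n)%:R : R) / n%:R @[n --> \oo] --> r)%classic)
  (r_gt0 : 0 < r).

Let fid n := fid_maxent (Lam (tpow rho n)).

Let m_posr n : 0 < (m n)%:R :> R. Proof. by rewrite ltr0n. Qed.

Let bounds n := one_way_LOCC_bounds (m_gt0 n) (tpow_density n drho) (@hLam n).

(** Once the fidelity exceeds 1/2, the bound by D^n / m gives m <= 2 D^n, so ln m / n <= ln D + ln 2
    / n. One half of e covers ln 2 / n, the other the distance of ln m / n from r. *)
Lemma rate_le_ln_dim : r <= ln D%:R.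
Proof.
have D0 : 0 < D%:R :> R by rewrite ltr0n; lia.
apply/ler_addgt0Pr => e e0.
have e2 : 0 < e / 2 by rewrite divr_gt0.
have hr : \forall n \near \oo, r - e / 2 < ln (m n)%:R / n%:R.
  by apply: (cvgr_gt r cvg_rate); lra.
have hf : \forall n \near \oo, 2^-1 < fid n by apply: (cvgr_gt 1 cvg_fid); lra.
have [n [[h1 h2] [h3 n0]]] : exists n, ((r - e / 2 < ln (m n)%:R / n%:R) /\ 2^-1 < fid n)
    /\ (ln 2 / (e / 2) < n%:R /\ (0 < n)%N).
  apply: (@filter_ex _ \oo); apply: filterI; apply: filterI.
  - exact: hr.
  - exact: hf.
  - exact: nbhs_infty_gtr.
  - exact: nbhs_infty_gt.
have n0r : 0 < n%:R :> R by rewrite ltr0n.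
have mD : (m n)%:R <= 2 * D%:R ^+ n :> R.
  have [_ + _] := bounds n; rewrite maxn_expn natrX -/(fid n) ler_pdivlMr // => h4.
  have := ltr_pM2r (m_posr n) 2^-1 (fid n); rewrite h2 => h5; lra.
have : ln (m n)%:R <= ln (2 * D%:R ^+ n) :> R.
  by rewrite ler_ln ?posrE ?mulr_gt0 ?exprn_gt0.
rewrite lnM ?posrE ?exprn_gt0 // lnXn // -[ln D%:R *+ n]mulr_natl.
move: h1 h3; rewrite ltr_pdivlMr // ltr_pdivrMr // => h1 h3 h4.
have : (r - e / 2) * n%:R < (e / 2 + ln D%:R) * n%:R by lra.
rewrite ltr_pM2r //; lra.
Qed.

(** Eventually ln m > n r / 2, and ln m <= m - 1 turns this into linear growth of m, which
    suffices. *)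
Lemma m_large (c : R) : \forall n \near \oo, c < (m n)%:R.
Proof.
have hr : \forall n \near \oo, r / 2 < ln (m n)%:R / n%:R.
  by apply: (cvgr_gt r cvg_rate); move: r_gt0; lra.
near=> n.
have n0 : 0 < n%:R :> R by rewrite ltr0n; near: n; exact: nbhs_infty_gt.
have h1 : r / 2 < ln (m n)%:R / n%:R by near: n; exact: hr.
have h2 : c / (r / 2) < n%:R by near: n; exact: nbhs_infty_gtr.
have h3 : ln (m n)%:R <= (m n)%:R - 1 :> R.
  by have := ln_le_tangent ltr01 (m_posr n); rewrite ln1 add0r divr1.
move: h1 h2; rewrite ltr_pdivlMr // ltr_pdivrMr ?divr_gt0 //; lra.
Unshelve. all: by end_near.
Qed.

Lemma relent_near_ln2 (e : R) : 0 < e ->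
  \forall n \near \oo, forall sigma, sym_extendible sigma ->
    ((ln 2 - e)%:E <= relent (embed (tpow rho n)) sigma)%E.
Proof.
(* With lam = 1 / eta, 1 - fid < eta^2 and 1 / (2 m) < eta, the argument x of the logarithm is at
   most 1/2 + 2 eta. The tangent at 1/2 has slope 2 and costs 4 eta; ln (1 + 1 / lam) costs the
   fifth eta. *)
move=> e0; pose eta := e / 5; have eta0 : 0 < eta by rewrite divr_gt0.
pose lam := eta^-1; have lam0 : 0 < lam by rewrite invr_gt0.
have eta2 : 0 < eta ^+ 2 by rewrite exprn_gt0.
have hf : \forall n \near \oo, 1 - eta ^+ 2 < fid n.
  by apply: (cvgr_gt 1 cvg_fid); lra.
near=> n => sigma hs.
have h1 : 1 - eta ^+ 2 < fid n by near: n; exact: hf.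
have h2 : (2 * eta)^-1 < (m n)%:R by near: n; exact: m_large.
have [f1 _ /(_ sigma lam hs lam0)] := bounds n; apply: le_trans; rewrite lee_fin -/(fid n).
have lf : lam * (1 - fid n) <= eta.
  rewrite ler_pdivrMl // -expr2; lra.
have mf : (m n).+1%:R / (2 * (m n)%:R) <= 2^-1 + eta :> R.
  rewrite ler_pdivrMr ?mulr_gt0 // -natr1.
  move: h2; rewrite -ltf_pV2 ?posrE ?invr_gt0 ?mulr_gt0 // invrK.
  move=> h2; have : (m n)%:R^-1 * (m n)%:R < 2 * eta * (m n)%:R by rewrite ltr_pM2r.
  rewrite mulVf ?gt_eqF //; lra.
have q0 : 0 < (m n).+1%:R / (2 * (m n)%:R) :> R.
  by rewrite divr_gt0 ?mulr_gt0 ?ltr0n.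
set x := lam * (1 - fid n) + _.
have x0 : 0 < x by rewrite ltr_wpDl // mulr_ge0 ?subr_ge0 // ltW.
have lnx : ln x <= - ln 2 + 4 * eta.
  have -> : - ln 2 = ln (2^-1) :> R by rewrite lnV ?posrE.
  have h : 0 < 2^-1 :> R by rewrite invr_gt0.
  have := ln_le_tangent h x0; rewrite invrK /x; lra.
have : ln (1 + lam^-1) <= eta by rewrite /lam invrK le_ln1Dx //; lra.
rewrite /eta in lnx *; lra.
Unshelve. all: by end_near.
Qed.

Lemma ln_dim_le_R_E_inf : ((ln D%:R)%:E <= R_E_inf rho)%E.
Proof.
have l2 : 0 < ln 2 :> R by rewrite ln_gt0 // ltr1n.
have lD : 0 < ln D%:R :> R by rewrite ln_gt0 // ltr1n.
apply/lee_addgt0Pr => e e0; rewrite -leeBlDr //.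
(* The first bound keeps the loss e' ln D / ln 2 below e; the second keeps ln 2 - e' positive, so
   that the lower bound on [delta_d] may be multiplied by it. *)
pose e' := Num.min (e * ln 2 / ln D%:R) (ln 2 / 2).
have e'0 : 0 < e' by rewrite lt_min !divr_gt0 ?mulr_gt0.
have e'l : e' <= e * ln 2 / ln D%:R by rewrite ge_min lexx.
have e'2 : e' <= ln 2 / 2 by rewrite ge_min lexx orbT.
apply: limn_esup_ge.
have hn := relent_near_ln2 e'0.
near=> n.
have n0 : (0 < n)%N by near: n; exact: nbhs_infty_gt.
have n0r : 0 < n%:R :> R by rewrite ltr0n.
rewrite -EFinB lee_pdivlMr // -EFinM /R_E.
have hd : n%:R * (ln D%:R / ln 2) <= delta_d R (maxn (dA ^ n) (dB ^ n)).
  by rewrite maxn_expn delta_d_ge.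
apply: le_trans (_ : ((delta_d R (maxn (dA ^ n) (dB ^ n)))%:E * (ln 2 - e')%:E <= _)%E).
  rewrite -EFinM lee_fin.
  apply: le_trans (_ : n%:R * (ln D%:R / ln 2) * (ln 2 - e') <= _).
    rewrite mulrC -mulrA ler_pM2l //.
    move: e'l; rewrite ler_pdivlMr // => e'l.
    have : ln D%:R / ln 2 * e' <= e by rewrite mulrAC ler_pdivrMr //; lra.
    rewrite mulrBr divfK ?gt_eqF //; lra.
  by apply: ler_wpM2r hd; lra.
apply: lee_wpmul2l; first by rewrite lee_fin delta_d_ge0.
apply/ereal_infP => _ [sigma hs <-].
by move: sigma hs; near: n.
Unshelve. all: by end_near.
Qed.

End Achieved.
End Rate.
End Asymptotics.

Unset Implicit Arguments.

Theorem mainTheorem10 (R : realType) (dA dB : nat) (rho : 'M[R[i]]_(dA * dB)) :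
  (2 <= maxn dA dB)%N -> density rho ->
  (D_oneway rho <= R_E_inf rho)%E.
Proof.
move=> D2 drho; apply/ereal_supP => _ [r [m [Lam [m0 hLam hf hr]]] <-].
(* For r <= 0 the dimensions m_n need not grow, and nonnegativity of the right-hand side is
   enough. *)
have [r0|r0] := leP r 0.
  by apply: le_trans (R_E_inf_ge0 D2 drho); rewrite lee_fin.
apply: le_trans (ln_dim_le_R_E_inf D2 drho m0 hLam hf hr r0).
by rewrite lee_fin (rate_le_ln_dim D2 drho m0 hLam hf hr).
Qed.
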